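(* Let $1\le p\le q\le r$ and $1\le p'\le q'\le r'$ be integers. If $T_4(p,q,r)$ and $T_4(p',q',r')$ have the same adjacency spectrum, then $(p,q,r)=(p',q',r')$, i.e. the two graphs are isomorphic.
   Context: All graphs are finite, simple and undirected; the adjacency spectrum of a graph is the multiset of eigenvalues of its adjacency matrix. For integers $p,q,r\ge 1$, $T_4(p,q,r)$ is the tree obtained as follows: take a central vertex $c$ and three further vertices $a,b,d$; join $c$ to $a$, $b$, $d$ by internally vertex-disjoint paths with $p$, $q$, $r$ edges respectively; then attach two pendant vertices to each of $a$, $b$, $d$. It has $p+q+r+7$ vertices, exactly $4$ vertices of degree $3$ and $6$ leaves. *)

(* Defs.v *)
From mathcomp Require Import all_boot all_order all_algebra all_field.

Set Implicit Arguments.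
Unset Strict Implicit.
Unset Printing Implicit Defensive.

Import GRing.Theory.

Record graph := Graph {
  vertex :> finType;
  adj : rel vertex;
  adj_sym : symmetric adj;
  adj_irrefl : irreflexive adj
}.

Definition isomorphic (G H : graph) : Prop :=
  exists2 f : G -> H, bijective f & forall u v : G, adj (f u) (f v) = adj u v.

Definition adjmx (G : graph) : 'M[algC]_#|G| :=
  \matrix_(i, j) ((adj (enum_val i) (enum_val j))%:R)%R.

(* The eigenvalues listed with multiplicity, in an arbitrary order: the list of
   roots in [algC] of the monic polynomial [char_poly (adjmx G)].  As [adjmx G]
   is real symmetric, they are all real and their algebraic and geometric
   multiplicities agree. *)
Definition spectrum (G : graph) : seq algC :=
  sval (closed_field_poly_normal (char_poly (adjmx G))).

(* Equality of multisets. *)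
Definition cospectral (G H : graph) : Prop := perm_eq (spectrum G) (spectrum H).

Section T4.

Variables p q r : nat.

Definition T4_arm (i : 'I_3) : nat := nth 0 [:: p; q; r] i.

(* - [inl (inl tt)] is the centre c;
   - [inl (inr (Tagged _ k))], with tag [i], is the vertex at distance k + 1
     from c on the i-th path, so that for k + 1 = [T4_arm i] it is the end of
     that path (a, b or d);
   - [inr (i, x)], for x : bool, are the two pendant vertices attached to the
     end of the i-th path. *)
Definition T4_vertex : finType :=
  (unit + {i : 'I_3 & 'I_(T4_arm i)} + 'I_3 * bool)%type.

(* The edges, oriented away from c. *)
Definition T4_arc : rel T4_vertex := fun u v =>
  match u, v with
  | inl (inl _), inl (inr y) => tagged y == 0 :> nat
  | inl (inr x), inl (inr y) =>
      (tag x == tag y) && (tagged y == (tagged x).+1 :> nat)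
  | inl (inr x), inr y => (tag x == y.1) && ((tagged x).+1 == T4_arm (tag x))
  | _, _ => false
  end.

Definition T4_adj : rel T4_vertex := fun u v => T4_arc u v || T4_arc v u.

Lemma T4_adj_sym : symmetric T4_adj.
Proof. by move=> u v; rewrite /T4_adj orbC. Qed.

Lemma T4_adj_irrefl : irreflexive T4_adj.
Proof.
by case=> [[[]|x]|y]; rewrite /T4_adj // /= orbb eqxx /= (ltn_eqF (ltnSn _)).
Qed.

Definition T4 : graph := Graph T4_adj_sym T4_adj_irrefl.

End T4.

(* Main.v *)
Require Import Defs.
From mathcomp Require Import all_boot all_order all_algebra all_field.
From mathcomp Require Import fingroup perm ring zify.

(* Put x = t + 1/t and C n = t^n + t^-n.  Eliminating the vertices of T_4(p,q,r)
   from the leaves to the centre turns the characteristic polynomial at x into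
     (C 1)^3 * (C (n + 4) - 2 C (n + 2) - C u - C v - C w),
   where n = p + q + r, u = n - 2p, v = n - 2q and w = |n - 2r|, so that
   u >= v >= w.  The number of vertices gives n.  As n fixes the parity of u and
   v, and 3 C m < C (m + 2) already for the single value t = 3, the sum
   C u + C v + C w determines u and then v, that is, p and q. *)

Set Implicit Arguments.
Unset Strict Implicit.
Unset Printing Implicit Defensive.

Import Order.TTheory GRing.Theory Num.Theory.

(** * Determinants by elimination on a rooted forest *)

Section Determinants.

Local Open Scope ring_scope.

(* The height is not assumed injective, so no reordering of the indices is
   needed: a permutation contributing to the Leibniz sum cannot decrease the
   height at a moved index, and the sum of the heights is invariant. *)
Lemma det_height_trig (R : comPzRingType) n (L : 'M[R]_n) (h : 'I_n -> nat) :
    (forall i j, i != j -> L i j != 0 -> (h i < h j)%N) ->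
  \det L = \prod_i L i i.
Proof.
move=> hL; rewrite /determinant (bigD1 (1%g : {perm _})) //= odd_perm1 mul1r.
under eq_bigr do rewrite perm1.
rewrite [X in _ + X]big1 ?addr0 // => s s1; apply/eqP; apply: contraT => nz.
have Ls i : L i (s i) != 0.
  apply: contraNneq nz => Li0.
  by rewrite (bigD1 i) //= Li0 mul0r mulr0.
have hs i : (h i <= h (s i))%N.
  by have [<-//|ne] := eqVneq i (s i); apply/ltnW/hL.
case/eqP: s1; apply/permP => i; rewrite perm1; apply/eqP.
rewrite eq_sym; apply: contraT => ne.
have : (\sum_j h j < \sum_j h (s j))%N.
  rewrite (bigD1 i) //= [ltnRHS](bigD1 i) //= -addSn leq_add ?hL //.
  exact: leq_sum.
rewrite [ltnLHS](reindex_inj (@perm_inj _ s)) /=.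
by rewrite ltnn.
Qed.

(* [xI - A = L D L^T] with [D = diag d] and [L u w = - 1 / d w] on each arc
   from [u] to [w]: Gaussian elimination from the leaves to the roots. *)
Lemma horner_char_poly_forest (G : graph) (arc : rel G) (h : G -> nat)
    (d : G -> algC) (x : algC) :
    (forall u v, adj u v = arc u v || arc v u) ->
    (forall u v, arc u v -> (h u < h v)%N) ->
    (forall u v w, arc u w -> arc v w -> u = v) ->
    (forall u v, arc u v -> d v != 0) ->
    (forall u, d u = x - \sum_(v | arc u v) (d v)^-1) ->
  (char_poly (adjmx G)).[x] = \prod_u d u.
Proof.
move=> adjE harc arc_uniq d0 dE.
pose l (u w : G) : algC := (u == w)%:R - (arc u w)%:R / d w.
have arcF u : arc u u = false by apply/negP => /harc; rewrite ltnn.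
pose L := \matrix_(i < #|G|, j < #|G|) l (enum_val i) (enum_val j).
pose D := diag_mx (\row_(j < #|G|) d (enum_val j)).
have -> : (char_poly (adjmx G)).[x] = \det (x%:M - adjmx G).
  rewrite /char_poly -[LHS]/(horner_eval x _) -det_map_mx; congr (\det _).
  apply/matrixP => i j; rewrite !mxE.
  by rewrite /= /horner_eval hornerD hornerN hornerMn hornerX hornerC.
have -> : x%:M - adjmx G = L *m D *m L^T.
  apply/matrixP => i j; rewrite mul_mx_diag !mxE adjE.
  under eq_bigr do rewrite !mxE.
  rewrite -(inj_eq enum_val_inj).
  set u := enum_val i; set v := enum_val j.
  rewrite -(big_enum_val (A := G) (fun w => l u w * d w * l v w)) /=.
  (* Multiplying out, [d w] cancels one factor [1 / d w]; it is known to be nonzero exactly where an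
     arc enters [w]. *)
  transitivity (\sum_w ((w == u)%:R * ((w == v)%:R * d w)
      - (w == u)%:R * (arc v w)%:R - (w == v)%:R * (arc u w)%:R
      + (arc u w && arc v w)%:R / d w)); last first.
    apply: eq_bigr => w _; rewrite /l [u == w]eq_sym [v == w]eq_sym.
    case: (boolP (arc u w)) (@d0 u w) => /= [_ /(_ isT) dw|_ _];
    case: (boolP (arc v w)) (@d0 v w) => /= [_ /(_ isT) dw'|_ _];
      rewrite ?mul0r; by field.
  have delta (a : G) (f : G -> algC) : \sum_w (w == a)%:R * f w = f a.
    rewrite (bigD1 a) //= eqxx mul1r big1 ?addr0 // => w /negPf->.
    by rewrite mul0r.
  rewrite !big_split /= !sumrN !delta.
  (* A vertex has at most one predecessor, so elimination creates no new off-diagonal entry. *)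
  have -> : \sum_w (arc u w && arc v w)%:R / d w
      = (u == v)%:R * \sum_(w | arc u w) (d w)^-1.
    rewrite mulr_sumr [RHS]big_mkcond /=; apply: eq_bigr => w _.
    have [|_] /= := boolP (arc u w); last by rewrite mul0r.
    move=> uw; have [<-|ne] := eqVneq u v; first by rewrite uw.
    by case: (boolP (arc v w)) => [vw|]; rewrite ?mul0r //;
      rewrite (arc_uniq _ _ _ uw vw) eqxx in ne.
  have [<-|ne] := eqVneq u v; first by rewrite arcF dE /=; ring.
  have : arc u v && arc v u = false.
    by apply/negP => /andP[/harc uv /harc vu]; have := ltn_trans uv vu;
       rewrite ltnn.
  by case: (arc u v) (arc v u) => [] [] //= _; ring.
rewrite !det_mulmx det_tr det_diag.
have -> : \det L = 1.
  rewrite (@det_height_trig _ _ L (fun i => h (enum_val i))).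
    by rewrite big1 // => i _; rewrite mxE /l eqxx arcF mul0r subr0.
  move=> i j ne; rewrite mxE /l (inj_eq enum_val_inj) (negPf ne).
  by case: (boolP (arc _ _)) => [/harc//|_]; rewrite mul0r subr0 eqxx.
rewrite mul1r mulr1 (big_enum_val (A := G) d).
by apply: eq_bigr => i _; rewrite mxE.
Qed.

Lemma cospectral_char_poly (G H : graph) :
  cospectral G H -> char_poly (adjmx G) = char_poly (adjmx H).
Proof.
rewrite /cospectral /spectrum.
case: closed_field_poly_normal => /= s ->.
case: closed_field_poly_normal => /= s' ->.
rewrite !(monicP (char_poly_monic _)) !scale1r.
exact: perm_big.
Qed.

Lemma cospectral_card (G H : graph) : cospectral G H -> #|G| = #|H|.
Proof.
move/cospectral_char_poly/(congr1 (fun P : {poly algC} => size P)).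
by rewrite !size_char_poly => -[].
Qed.

End Determinants.

(** * Symmetric powers of [t] *)

Section SymmetricPowers.

Local Open Scope ring_scope.

(** As a function of [C 1] this is [2 T_n(C 1 / 2)], with [T_n] the Chebyshev polynomial of the
    first kind. *)
Definition sympow (F : fieldType) (t : F) (n : nat) : F := t ^+ n + t ^- n.

Variables (F : numFieldType) (t : F).
Hypothesis t_gt0 : 0 < t.

Local Notation C := (sympow t).

Lemma sympow_gt0 n : 0 < C n.
Proof. by rewrite /sympow addr_gt0 ?invr_gt0 ?exprn_gt0. Qed.

Lemma sympow_neq0 n : C n != 0.
Proof. by rewrite gt_eqF ?sympow_gt0. Qed.

Lemma sympow_step n : C n.+2 = C 1 * C n.+1 - C n.
Proof.
rewrite /sympow !exprS expr0.
have tn0 := expf_neq0 n (lt0r_neq0 t_gt0).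
move: (lt0r_neq0 t_gt0) tn0 => t0; set y := t ^+ n => y0.
by field; rewrite y0.
Qed.

(* Multiplied out, the left-hand side is a sum over signs of powers of [t];
   [C 1] times a product with one minus sign cancels against the subtracted
   terms except in a single power, hence the short right-hand side. *)
Lemma sympow_T4 p q r : (p <= q)%N -> (q <= r)%N ->
  C p.+1 * C q.+1 * C r.+1
    * (C 1 - (C p / C p.+1 + C q / C q.+1 + C r / C r.+1))
  = C (p + q + r + 4) - C (p + q + r + 2) *+ 2
    - (C (q + r - p) + C (p + r - q) + C `|p + q - r|).
Proof.
move=> lpq lqr.
have Cp := sympow_neq0 p.+1; have Cq := sympow_neq0 q.+1.
have Cr := sympow_neq0 r.+1.
have t0 := lt0r_neq0 t_gt0.
have expB m n : (n <= m)%N -> t ^+ (m - n) = t ^+ m / t ^+ n.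
  by move=> lnm; rewrite expfB_cond // (negPf t0) add0n.
(* The exponents [n] and [-n] enter symmetrically, so the sign of [p + q - r] is immaterial. *)
have -> : C `|p + q - r| = t ^+ (p + q) / t ^+ r + t ^+ r / t ^+ (p + q).
  have [le|/ltnW le] := leqP r (p + q).
    by rewrite distnEl // /sympow expB // invf_div.
  by rewrite distnEr // /sympow expB // invf_div addrC.
transitivity (C 1 * C p.+1 * C q.+1 * C r.+1 - C p * C q.+1 * C r.+1
   - C p.+1 * C q * C r.+1 - C p.+1 * C q.+1 * C r); first by field; apply/and3P.
rewrite /sympow !expB; try lia.
rewrite !exprD !exprS !expr0.
have := expf_neq0 p t0; have := expf_neq0 q t0; have := expf_neq0 r t0.
set P := t ^+ p; set Q := t ^+ q; set R := t ^+ r => P0 Q0 R0.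
by field; rewrite ?t0 ?P0 ?Q0 ?R0.
Qed.

End SymmetricPowers.

(** * Growth at [t = 3] and sums of three terms *)

Section Growth.

Local Open Scope ring_scope.

Variable F : numFieldType.

Local Notation C := (sympow (3 : F)).

Lemma sympow3_le : {homo C : m n / (m <= n)%N >-> m <= n}.
Proof.
apply: homo_leq => [//|x y z|n]; first exact: le_trans.
rewrite /sympow !exprS.
have : 1 <= (3 : F) ^+ n by rewrite exprn_ege1 // ler1n.
set y := 3 ^+ n => y1; have y0 : 0 < y := lt_le_trans ltr01 y1.
have yV : y^-1 <= y by rewrite (le_trans _ y1) // invf_le1.
rewrite -subr_ge0.
(* Both summands are nonnegative because [y^-1 <= 1 <= y]. *)
have -> : 3 * y + (3 * y)^-1 - (y + y^-1) = 2 * (y - y^-1) + 4 / 3 * y^-1.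
  by field; rewrite gt_eqF.
by rewrite addr_ge0 // mulr_ge0 ?subr_ge0 // ?divr_ge0 // ltW ?invr_gt0.
Qed.

Lemma sympow3_lt n : C n + C n + C n < C n.+2.
Proof.
rewrite /sympow !exprS.
have : 1 <= (3 : F) ^+ n by rewrite exprn_ege1 // ler1n.
set y := 3 ^+ n => y1; have y0 : 0 < y := lt_le_trans ltr01 y1.
have yV : y^-1 <= y by rewrite (le_trans _ y1) // invf_le1.
rewrite -subr_gt0.
have -> : 3 * (3 * y) + (3 * (3 * y))^-1 - (y + y^-1 + (y + y^-1) + (y + y^-1))
    = 6 * (y - y^-1) + 28 / 9 * y^-1 by field; rewrite gt_eqF.
by rewrite ltr_wpDl ?mulr_ge0 ?subr_ge0 // mulr_gt0 ?divr_gt0 ?invr_gt0.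
Qed.

(** If [u < u'], equal parity gives [u + 2 <= u'], so the left sum is at most
    [3 f u < f (u + 2) <= f u'], a contradiction; symmetrically for [u' < u]. After cancelling
    [f u], two terms are compared in the same way. *)
Lemma fast_growth_sum_inj (f : nat -> F) u v w u' v' w' :
    (forall n, 0 < f n) -> {homo f : m n / (m <= n)%N >-> m <= n} ->
    (forall n, f n + f n + f n < f n.+2) ->
    (w <= v)%N -> (v <= u)%N -> (w' <= v')%N -> (v' <= u')%N ->
    odd u = odd u' -> odd v = odd v' ->
    f u + f v + f w = f u' + f v' + f w' ->
  u = u' /\ v = v'.
Proof.
move=> f0 f_le f_lt.
have aux2 v1 w1 v2 w2 : (w1 <= v1)%N -> (v1.+2 <= v2)%N ->
    f v1 + f w1 != f v2 + f w2.
  move=> lwv lv; rewrite lt_eqF // ltr_pwDr //.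
  apply: le_trans (f_le _ _ lv); apply: le_trans (ltW (f_lt v1)).
  by rewrite -addrA lerD2l (le_trans (f_le _ _ lwv)) // lerDl ltW.
have aux3 u1 v1 w1 u2 v2 w2 : (w1 <= v1)%N -> (v1 <= u1)%N -> (u1.+2 <= u2)%N ->
    f u1 + f v1 + f w1 != f u2 + f v2 + f w2.
  move=> lwv lvu lu; rewrite lt_eqF // -!addrA ltr_pwDr ?addr_gt0 //.
  apply: le_trans (f_le _ _ lu); apply: le_trans (ltW (f_lt u1)).
  by rewrite addrA !lerD ?f_le //; exact: leq_trans lvu.
move=> lwv lvu lwv' lvu' ou ov e.
have uE : u = u'.
  case: (ltngtP u u') => // lt.
    have lt2 : (u.+2 <= u')%N by lia.
    by have := aux3 _ _ _ _ v' w' lwv lvu lt2; rewrite e eqxx.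
  have lt2 : (u'.+2 <= u)%N by lia.
  by have := aux3 _ _ _ _ v w lwv' lvu' lt2; rewrite e eqxx.
split=> //; move: e; rewrite uE -!addrA => /addrI e.
case: (ltngtP v v') => // lt.
  have lt2 : (v.+2 <= v')%N by lia.
  by have := aux2 _ _ _ w' lwv lt2; rewrite e eqxx.
have lt2 : (v'.+2 <= v)%N by lia.
by have := aux2 _ _ _ w lwv' lt2; rewrite e eqxx.
Qed.

End Growth.

(** * Vertex count and characteristic polynomial of [T4] *)

Lemma card_T4 p q r : #|T4 p q r| = p + q + r + 7.
Proof.
rewrite !card_sum card_unit card_prod card_ord card_bool.
rewrite card_tagged sumnE big_map big_enum /= !big_ord_recl big_ord0 !card_ord.
by rewrite /T4_arm /=; lia.
Qed.

Section T4Spectrum.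

Local Open Scope ring_scope.

Variables (p q r : nat) (t : algC).
Hypotheses (p_gt0 : (0 < p)%N) (q_gt0 : (0 < q)%N) (r_gt0 : (0 < r)%N).
Hypothesis t_gt0 : 0 < t.

Local Notation C := (sympow t).
Local Notation arm := (T4_arm p q r).

Lemma T4_arm_gt0 i : (0 < arm i)%N.
Proof. by case: i => [[|[|[|]]]]. Qed.

Definition T4_height (v : T4 p q r) : nat :=
  match v with
  | inl (inl _) => 0
  | inl (inr y) => (tagged y).+1
  | inr (i, _) => (arm i).+1
  end.

(* The characteristic polynomial at [C 1] of the last [m] vertices of an arm
   together with its two leaves is [C 1 * C m.+1]. *)
Definition T4_pivot (v : T4 p q r) : algC :=
  match v with
  | inl (inl _) => C 1 - \sum_i C (arm i) / C (arm i).+1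
  | inl (inr y) => let m := (arm (tag y) - tagged y)%N in C m.+1 / C m
  | inr _ => C 1
  end.

Lemma T4_arc_height (u v : T4 p q r) :
  T4_arc u v -> (T4_height u < T4_height v)%N.
Proof.
case: u v => [[[]|[i k]]|[i b]] [[[]|[j l]]|[j c]] //=.
- by case/andP=> _ /eqP->.
- by case/andP=> /eqP<- /eqP->.
Qed.

Lemma T4_arc_uniq (u v w : T4 p q r) : T4_arc u w -> T4_arc v w -> u = v.
Proof.
case: w => [[[]|[j l]]|[j c]]; case: u => [[[]|[i k]]|[i b]] //=;
  case: v => [[[]|[i' k']]|[i' b']] //=.
- by move=> /eqP-> /andP[_ /eqP].
- by move=> /andP[_ /eqP->] /eqP.
- move=> /andP[/eqP ij /eqP kl] /andP[/eqP i'j /eqP kl']; subst i i'.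
  suff -> : k = k' by [].
  by apply/val_inj/succn_inj; rewrite -kl -kl'.
- move=> /andP[/eqP ij /eqP kl] /andP[/eqP i'j /eqP kl']; subst i i'.
  suff -> : k = k' by [].
  by apply/val_inj/succn_inj; rewrite kl'.
Qed.

(** No arc enters the centre, whose pivot may vanish; every other pivot is built from positive
    values of [C]. *)
Lemma T4_pivot_neq0 (u v : T4 p q r) : T4_arc u v -> T4_pivot v != 0.
Proof.
have C0 := sympow_neq0 t_gt0.
by case: u v => [[[]|?]|?] [[[]|?]|?] //= _; rewrite ?mulf_neq0 ?invr_eq0.
Qed.

Lemma T4_pivotE (u : T4 p q r) :
  T4_pivot u = C 1 - \sum_(v | T4_arc u v) (T4_pivot v)^-1.
Proof.
have C0 := sympow_neq0 t_gt0.
rewrite big_sumType big_sumType /=.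
case: u => [[[]|[i k]]|[i b]] /=; last 1 first.
- by rewrite !big_pred0 // !addr0 subr0.
- rewrite [X in _ - (X + _ + _)]big_pred0 // [X in _ - (_ + X)]big_pred0 // add0r addr0.
  congr (_ - _).
  rewrite -(sig_big_dep (fun=> true) (fun i (k : 'I_(arm i)) => k == 0 :> nat)
    (fun i k => (C (arm i - k).+1 / C (arm i - k))^-1)) /=.
  apply: eq_bigr => i _.
  by rewrite (big_pred1 (Ordinal (T4_arm_gt0 i))) //= subn0 invf_div.
- rewrite [X in _ - (X + _ + _)]big_pred0 // add0r.
  (* At the end of an arm the two leaves contribute [2 / C 1 = C 0 / C 1], so the recurrence for [C]
     applies there as it does at an inner vertex, whose only successor is the next one on the
     arm. *)
  have [kE|kN] := eqVneq k.+1 (arm i).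
    rewrite [X in _ - (X + _)]big_pred0 ?add0r; last first.
      move=> [j l] /=; apply/negP => /andP[/eqP ij /eqP lk]; subst j.
      by have := ltn_ord l; rewrite lk kE ltnn.
    rewrite -(pair_big_dep (fun j => i == j) (fun _ (_ : bool) => true)
      (fun _ _ => (C 1)^-1)) /=.
    rewrite (big_pred1 i) => [|j]; last by rewrite eq_sym.
    have -> : (arm i - k)%N = 1 by lia.
    have C00 : C 0 = 2 by rewrite /sympow expr0 invr1.
    by rewrite big_bool (sympow_step t_gt0 0) C00 /=; field; rewrite C0.
  rewrite [X in _ - (_ + X)]big_pred0 ?addr0; last by move=> [j c]; rewrite andbF.
  have kS : (k.+1 < arm i)%N by rewrite ltn_neqAle kN ltn_ord.
  rewrite (big_pred1 (Tagged (fun i => 'I_(arm i)) (Ordinal kS))) /=; last first.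
    move=> y; apply/idP/eqP => [|->]; last by rewrite /= !eqxx.
    case: y => j l /= /andP[/eqP ij /eqP lk]; subst j.
    by congr existT; apply: val_inj.
  rewrite invf_div subnS; case: (arm i - k)%N (subn_gt0 k (arm i)) => [|m] /=.
    by rewrite ltn_ord.
  by move=> _; rewrite (sympow_step t_gt0); field.
Qed.

Lemma horner_char_poly_T4 :
  (char_poly (adjmx (T4 p q r))).[C 1]
  = C 1 ^+ 3 * (C p.+1 * C q.+1 * C r.+1
    * (C 1 - (C p / C p.+1 + C q / C q.+1 + C r / C r.+1))).
Proof.
have C0 := sympow_neq0 t_gt0.
rewrite (horner_char_poly_forest _ T4_arc_height T4_arc_uniq T4_pivot_neq0
  T4_pivotE) //.
rewrite big_sumType big_sumType /= big_const card_unit /= mulr1.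
rewrite !big_ord_recl big_ord0 /= addr0 addrA.
rewrite -(sig_big_dep (fun=> true) (fun i (k : 'I_(arm i)) => true)
    (fun i k => (C (arm i - k).+1 / C (arm i - k)))) /=.
(* The three arms leave [C 1 ^- 3] and the six leaves give [C 1 ^+ 6], whence the factor
   [C 1 ^+ 3]. *)
have telescope n : \prod_(k < n) (C (n - k).+1 / C (n - k)) = C n.+1 / C 1.
  elim: n => [|n IHn]; first by rewrite big_ord0 divff.
  rewrite big_ord_recl subn0 (eq_bigr (fun k : 'I_n => C (n - k).+1 / C (n - k))).
    by rewrite IHn; field; rewrite !C0.
  by move=> k _; rewrite /= subSS.
under eq_bigr do rewrite telescope.
rewrite !big_ord_recl big_ord0 /= prodr_const card_prod card_ord card_bool /=.
by field; rewrite !C0.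
Qed.

End T4Spectrum.

(** * Recovering the arm lengths from the spectrum *)

Theorem theorem4p1 (p q r p' q' r' : nat)
    (hp : 1 <= p) (hpq : p <= q) (hqr : q <= r)
    (hp' : 1 <= p') (hpq' : p' <= q') (hqr' : q' <= r') :
  cospectral (T4 p q r) (T4 p' q' r') ->
  (p, q, r) = (p', q', r') /\ isomorphic (T4 p q r) (T4 p' q' r').
Proof.
move=> cosp.
have hq := leq_trans hp hpq; have hr := leq_trans hq hqr.
have hq' := leq_trans hp' hpq'; have hr' := leq_trans hq' hqr'.
have t0 : (0 < 3 :> algC)%R by rewrite ltr0n.
have sE : p + q + r = p' + q' + r'.
  by have := cospectral_card cosp; rewrite !card_T4; lia.
have := congr1 (fun P : {poly algC} => P.[sympow 3 1]%R)
  (cospectral_char_poly cosp).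
rewrite /= !horner_char_poly_T4 // !sympow_T4 // sE.
move/(mulfI (expf_neq0 3 (sympow_neq0 t0 1)))/addrI/oppr_inj.
(* The ordering [p <= q <= r] sorts the three indices, and the common value of [p + q + r] fixes
   their parity. *)
case/(fast_growth_sum_inj (@sympow_gt0 _ _ t0) (@sympow3_le algC)
  (@sympow3_lt algC)); try lia.
move=> uE vE.
have [pE qE rE] : [/\ p = p', q = q' & r = r'] by split; lia.
subst p' q' r'; split=> //.
by exists id => //; exists id.
Qed.
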